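(* Let $S$ be a surface in the $3$-dimensional real projective space $\mathbb P^3$ with $bc\neq 0$, given by a lift $f:\mathbb D\to\mathbb R^4\setminus\{\mathbf 0\}$ satisfying its canonical system, let $F$ be its Wilczynski frame (with values in $\mathrm{SL}_4\mathbb R$), and let $g_1 = F J_1 F^t:\mathbb D\to\mathcal Q$ be its first-order Gauss map. Then $g_1$ is conformal if and only if $S$ is a Demoulin surface.
   Context: Surfaces. $\mathbb D\subset\mathbb R^2$ is a simply connected domain with coordinates $(x,y)$; all functions are smooth. A surface $S$ in $\mathbb P^3$ is represented by a lift $f:\mathbb D\to\mathbb R^4\setminus\{\mathbf 0\}$ satisfying the canonical system $$f_{xx}=b f_y+p f,\qquad f_{yy}=c f_x+q f,$$ where $b,c,p,q$ are real functions of $(x,y)$ and $f,f_x,f_y,f_{xy}$ are linearly independent at each point. The coordinates $(x,y)$ are asymptotic coordinates of $S$, and the Lorentz conformal structure on $\mathbb D$ induced by $S$ is that for which $x,y$ are null coordinates (the conformal class of $dx\,dy$). It is assumed that $bc\ne0$ everywhere. Invariants. Put $$P = p + \frac{b_y}{2} -\frac{c_{xx}}{2 c} + \frac{c_x^2}{4 c^2},\qquad Q = q + \frac{c_x}{2} - \frac{b_{yy}}{2 b}+ \frac{b_y^2}{4 b^2}.$$ $S$ is a Demoulin surface if $P=Q=0$ identically. Wilczynski frame. $F=(f,f_1,f_2,\eta)$ (columns) with $$f_1=f_x-\frac{c_x}{2c}f,\quad f_2=f_y-\frac{b_y}{2b}f,\quad \eta=f_{xy}-\frac{c_x}{2c}f_y-\frac{b_y}{2b}f_x+\Big(\frac{b_yc_x}{4bc}-\frac{bc}{2}\Big)f.$$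 The determinant of $F$ is constant, and it is assumed throughout that $F$ takes values in $\mathrm{SL}_4\mathbb R$. First-order Gauss map. $J_1$ is the $4\times4$ matrix with entries $1$ on the anti-diagonal and $0$ elsewhere. $\mathcal Q$ is the space of real symmetric $4\times 4$ matrices of determinant one and signature $(2,2)$, on which $\mathrm{SL}_4\mathbb R$ acts transitively by $g\cdot p=gpg^t$; $\mathcal Q\cong\mathrm{SL}_4\mathbb R/K_1$ with $K_1=\{X\in\mathrm{SL}_4\mathbb R: XJ_1X^t=J_1\}\cong\mathrm{SO}_{2,2}$. The first-order Gauss map is $g_1=FJ_1F^t:\mathbb D\to\mathcal Q$. $\mathcal Q$ carries the $\mathrm{SL}_4\mathbb R$-invariant pseudo-Riemannian metric $\langle X,Y\rangle_p=\mathrm{Tr}(p^{-1}Xp^{-1}Y)$ for $X,Y\in T_p\mathcal Q$. Conformality. $g_1$ is conformal if the pullback of this metric by $g_1$ is a (function) multiple of $dx\,dy$, i.e. $\langle (g_1)_x,(g_1)_x\rangle=\langle (g_1)_y,(g_1)_y\rangle=0$. *)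

(* Defs.v *)
From HB Require Import structures.
From mathcomp Require Import all_boot all_order perm all_algebra.
From mathcomp Require Import all_classical all_reals all_analysis.
From mathcomp Require Import ring.

Set Implicit Arguments.
Unset Strict Implicit.
Unset Printing Implicit Defensive.
Import Order.TTheory GRing.Theory Num.Theory.
Import numFieldNormedType.Exports.
Local Open Scope classical_set_scope.
Local Open Scope ring_scope.

Section PartialDerivatives.
Context {R : realType} {W : normedModType R}.

Definition pdx (h : R * R -> W) : R * R -> W := fun z => 'D_(1, 0) h z.
Definition pdy (h : R * R -> W) : R * R -> W := fun z => 'D_(0, 1) h z.

(* [true] stands for d/dx and [false] for d/dy; the head of [s] is the last
   derivative taken. *)
Fixpoint iter_pd (s : seq bool) (h : R * R -> W) : R * R -> W :=
  if s is d :: s' then (if d then pdx else pdy) (iter_pd s' h) else h.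

(* C^infinity on an open set: the iterated partial derivatives of every order
   exist and are Frechet differentiable (hence continuous) on D. *)
Definition smooth_on (D : set (R * R)) (h : R * R -> W) : Prop :=
  forall (s : seq bool) (z : R * R), D z -> differentiable (iter_pd s h) z.

End PartialDerivatives.

Section SimplyConnected.
Context {R : realType} {T : topologicalType}.

Definition path_in (D : set T) (gamma : R -> T) : Prop :=
  {within `[0, 1], continuous gamma} /\
  (forall t, t \in `[0, 1] -> D (gamma t)).

Definition path_connected (D : set T) : Prop :=
  forall a b, D a -> D b ->
    exists2 gamma : R -> T, path_in D gamma & gamma 0 = a /\ gamma 1 = b.

(* H (s, t): s is the deformation parameter, t the loop parameter. *)
Definition null_homotopic_in (D : set T) (gamma : R -> T) : Prop :=
  exists (H : R * R -> T) (a : T),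
    [/\ {within `[0, 1] `*` `[0, 1], continuous H},
        (forall s t, s \in `[0, 1] -> t \in `[0, 1] -> D (H (s, t))),
        (forall t, t \in `[0, 1] -> H (0, t) = gamma t),
        (forall t, t \in `[0, 1] -> H (1, t) = a) &
        (forall s, s \in `[0, 1] -> H (s, 0) = H (s, 1))].

Definition simply_connected (D : set T) : Prop :=
  path_connected D /\
  (forall gamma : R -> T, path_in D gamma -> gamma 0 = gamma 1 ->
     null_homotopic_in D gamma).

End SimplyConnected.
Arguments simply_connected R {T} D.

Definition simply_connected_domain {R : realType} (D : set (R * R)) : Prop :=
  [/\ open D, D !=set0 & simply_connected R D].

Section ProjectiveSurfaces.
Context {R : realType}.
Implicit Types (D : set (R * R)) (f : R * R -> 'cV[R]_4).
Implicit Types (b c p q : R * R -> R).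

Record canonical_lift D f b c p q : Prop := CanonicalLift {
  lift_smooth : smooth_on D f;
  coeffs_smooth : [/\ smooth_on D b, smooth_on D c, smooth_on D p
                    & smooth_on D q];
  lift_neq0 : forall z, D z -> f z != 0;
  lift_xx : forall z, D z -> pdx (pdx f) z = b z *: pdy f z + p z *: f z;
  lift_yy : forall z, D z -> pdy (pdy f) z = c z *: pdx f z + q z *: f z;
  lift_free : forall z, D z ->
    free [:: f z; pdx f z; pdy f z; pdy (pdx f) z]
}.

Definition invP b c p : R * R -> R := fun z =>
  p z + pdy b z / 2 - pdx (pdx c) z / (2 * c z)
  + pdx c z ^+ 2 / (4 * c z ^+ 2).

Definition invQ b c q : R * R -> R := fun z =>
  q z + pdx c z / 2 - pdy (pdy b) z / (2 * b z)
  + pdy b z ^+ 2 / (4 * b z ^+ 2).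

Definition demoulin D b c p q : Prop :=
  forall z, D z -> invP b c p z = 0 /\ invQ b c q z = 0.

Definition frame1 f c : R * R -> 'cV[R]_4 := fun z =>
  pdx f z - (pdx c z / (2 * c z)) *: f z.

Definition frame2 f b : R * R -> 'cV[R]_4 := fun z =>
  pdy f z - (pdy b z / (2 * b z)) *: f z.

Definition frame_eta f b c : R * R -> 'cV[R]_4 := fun z =>
  pdy (pdx f) z - (pdx c z / (2 * c z)) *: pdy f z
  - (pdy b z / (2 * b z)) *: pdx f z
  + (pdy b z * pdx c z / (4 * b z * c z) - b z * c z / 2) *: f z.

Definition wilczynski_frame f b c : R * R -> 'M[R]_4 := fun z =>
  \matrix_(i < 4, j < 4)
    [:: f z; frame1 f c z; frame2 f b z; frame_eta f b c z]`_j i 0.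

Definition J1 : 'M[R]_4 := \matrix_(i < 4, j < 4) (i + j == 3)%N%:R.

Definition gauss1 f b c : R * R -> 'M[R]_4 := fun z =>
  wilczynski_frame f b c z *m J1 *m (wilczynski_frame f b c z)^T.

(* diag(1, 1, -1, -1) *)
Definition I22 : 'M[R]_4 := diag_mx (\row_(j < 4) (-1) ^+ (2 <= j)%N).

(* Signature (2,2), in the sense of Sylvester's law of inertia. *)
Definition spaceQ : set 'M[R]_4 :=
  [set A | [/\ A^T = A, \det A = 1 &
             exists2 B : 'M[R]_4, B \in unitmx & A = B *m I22 *m B^T]].

Definition metricQ (A X Y : 'M[R]_4) : R :=
  \tr (invmx A *m X *m invmx A *m Y).

(* The symmetric bilinear form dx dy on R^2. *)
Definition dxdy (v w : R * R) : R := (v.1 * w.2 + v.2 * w.1) / 2.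

Definition conformal D (g : R * R -> 'M[R]_4) : Prop :=
  exists lambda : R * R -> R, forall z, D z -> forall v w : R * R,
    metricQ (g z) ('d g z v) ('d g z w) = lambda z * dxdy v w.

Lemma J1_spaceQ : spaceQ J1.
Proof.
have J1_perm : J1 = perm_mx (tperm (0%R : 'I_4) (3%R : 'I_4) * tperm (1%R : 'I_4) (2%R : 'I_4))%g.
  apply/matrixP => i j; rewrite !mxE permM.
  by case: i => -[|[|[|[|//]]]] i4; case: j => -[|[|[|[|//]]]] j4;
    rewrite !permE /=.
have detJ1 : \det J1 = 1 by rewrite J1_perm det_perm odd_permM !odd_tperm.
pose B : 'M[R]_4 := \matrix_(i < 4, j < 4)
  (((i == j) || (i + j == 3)%N)%:R
   * ((-1) ^+ ((2 <= i) && (2 <= j))%N / 2 ^+ (2 <= i)%N)).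
have J1E : J1 = B *m I22 *m B^T.
  apply/matrixP => i j; rewrite mul_mx_diag !mxE !big_ord_recl big_ord0 !mxE.
  by case: i => -[|[|[|[|//]]]] i4; case: j => -[|[|[|[|//]]]] j4;
    rewrite /= ?(expr0, expr1); field.
split=> //.
  by apply/matrixP => i j; rewrite !mxE addnC.
exists B => //; rewrite unitmxE unitfE; apply/eqP => detB.
by move/eqP: detJ1; rewrite J1E !det_mulmx detB !mul0r eq_sym oner_eq0.
Qed.

Lemma gauss1_spaceQ D f b c :
  (forall z, D z -> \det (wilczynski_frame f b c z) = 1) ->
  forall z, D z -> spaceQ (gauss1 f b c z).
Proof.
move=> detF z /detF {}detF; have [J1T detJ1 [B Bu J1E]] := J1_spaceQ.
split.
- by rewrite /gauss1 !trmx_mul trmxK J1T mulmxA.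
- by rewrite /gauss1 !det_mulmx det_tr detF detJ1 !mulr1.
- exists (wilczynski_frame f b c z *m B).
    by rewrite unitmx_mul Bu unitmxE detF unitr1.
  by rewrite /gauss1 J1E trmx_mul !mulmxA.
Qed.

End ProjectiveSurfaces.

(* Main.v *)
(* If A is the coefficient matrix of F_x = F A, then g = F J1 F^t satisfies
   g^-1 g_x = F^-t N F^t with N = J1 A J1 + A^t, so <g_x, g_x> = Tr(N^2).  For
   the Wilczynski frame this trace equals 16 P: the entries of A involving
   further derivatives of b, c, p, q do not contribute.  Exchanging x
   with y merely swaps f_1 and f_2, which leaves F J1 F^t unchanged, so the same
   computation gives <g_y, g_y> = 16 Q.  Computing A requires
   f_xy = f_yx and f_xxy = f_xyx, i.e. the symmetry of second derivatives. *)
Require Import Defs.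
From mathcomp Require Import all_boot all_order all_algebra.
From mathcomp Require Import all_classical all_reals all_analysis.
From mathcomp Require Import ring lra.
Import Order.TTheory GRing.Theory Num.Theory.
Import numFieldNormedType.Exports.
Local Open Scope classical_set_scope.
Local Open Scope ring_scope.

(** * Differentiation rules for scalar functions given by formulas *)

Section PointwiseRules.
Context {R : realType} {V : normedModType R}.
Implicit Types (g h : V -> R) (z u : V) (dg dh : R).

(** This rule and the next ones are stated for explicit [fun w => ...], with the derivative as a
    parameter, so that they unify with formulas and let the derivative be synthesised. *)
Lemma is_deriveD_fun {g h z u dg dh} :
  is_derive z u g dg -> is_derive z u h dh ->
  is_derive z u (fun w => g w + h w) (dg + dh).
Proof. by move=> ? ?; exact: is_deriveD. Qed.

Lemma is_deriveB_fun {g h z u dg dh} :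
  is_derive z u g dg -> is_derive z u h dh ->
  is_derive z u (fun w => g w - h w) (dg - dh).
Proof. by move=> ? ?; exact: is_deriveB. Qed.

Lemma is_deriveM_fun {g h z u dg dh} :
  is_derive z u g dg -> is_derive z u h dh ->
  is_derive z u (fun w => g w * h w) (g z * dh + h z * dg).
Proof. by move=> ? ?; exact: is_deriveM. Qed.

Lemma is_deriveV_fun {h z u dh} : h z != 0 ->
  is_derive z u h dh ->
  is_derive z u (fun w => (h w)^-1) (- (h z) ^- 2 * dh).
Proof.
move=> hz [dhz <-]; apply: DeriveDef; first exact: derivableV.
exact: deriveV.
Qed.

(** The two difference quotients are the same function of [t]. This carries directional derivatives
    in [V] over to the real line, where the mean value theorem applies. *)
Lemma is_derive_line {h z u} {s dh : R} :
  is_derive (z + s *: u) u h dh ->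
  is_derive s (1 : R) (fun t => h (z + t *: u)) dh.
Proof.
move=> [hd hE].
have E : (fun t : R => t^-1 *: ((h \o shift (z + s *: u)) (t *: u)
            - h (z + s *: u)))
       = (fun t : R => t^-1 *: (((fun t => h (z + t *: u)) \o shift s) (t *: 1)
            - h (z + s *: u))).
  apply/funext => t /=; congr (_ *: (h _ - _)).
  by rewrite scalerDl addrCA -[t *: 1]/(t * 1) mulr1.
apply: DeriveDef; first by rewrite /derivable -E.
by rewrite /derive -E -hE.
Qed.

End PointwiseRules.

(** * Symmetry of mixed second derivatives *)

Section SymmetryOfSecondDerivatives.
Context {R : realType} {V : normedModType R}.

(** The second difference is the increment of h (z + e v + s u) - h (z + s u) as [s] runs from 0 to
    [e]. The mean value theorem along [u] turns it into an increment of [hu] along [v], and a second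
    use along [v] produces [huv]. *)
Lemma second_difference_MVT {h hu huv : V -> R} {u v z : V} {e : R} : 0 < e ->
  (forall s t, s \in `[0, e] -> t \in `[0, e] ->
    is_derive (z + s *: u + t *: v) u h (hu (z + s *: u + t *: v))) ->
  (forall s t, s \in `[0, e] -> t \in `[0, e] ->
    is_derive (z + s *: u + t *: v) v hu (huv (z + s *: u + t *: v))) ->
  exists s t, [/\ s \in `[0, e], t \in `[0, e] &
    h (z + e *: u + e *: v) - h (z + e *: u) - h (z + e *: v) + h z
    = huv (z + s *: u + t *: v) * e * e].
Proof.
move=> e0 hh hhu.
have in0 : 0 \in `[0, e] by rewrite in_itv /= lexx ltW.
have ine : e \in `[0, e] by rewrite in_itv /= lexx ltW.
have oc s : s \in `]0, e[ -> s \in `[0, e] by apply: subset_itv_oo_cc.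
have der1 s : s \in `[0, e] -> is_derive s (1 : R)
    (fun s => h (z + e *: v + s *: u) - h (z + s *: u))
    (hu (z + s *: u + e *: v) - hu (z + s *: u)).
  move=> sI; apply: is_deriveB_fun; apply: is_derive_line.
    by rewrite addrAC; exact: hh.
  by have := hh s 0 sI in0; rewrite scale0r addr0.
have [|s /oc sI] := MVT e0 (fun s sI => der1 s (oc s sI)).
  by apply: derivable_within_continuous => s sI; have [] := der1 s sI.
rewrite subr0 !scale0r !addr0 => E1.
have der2 t : t \in `[0, e] -> is_derive t (1 : R)
    (fun t => hu (z + s *: u + t *: v)) (huv (z + s *: u + t *: v)).
  by move=> tI; apply: is_derive_line; exact: hhu.
have [|t /oc tI] := MVT e0 (fun t tI => der2 t (oc t tI)).
  by apply: derivable_within_continuous => t tI; have [] := der2 t tI.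
rewrite subr0 !scale0r !addr0 => E2.
exists s, t; split=> //; rewrite -E2 -E1 (addrAC z (e *: u)); ring.
Qed.

Lemma near_parallelogram {u v z : V} {P : V -> Prop} :
  (\forall w \near z, P w) ->
  exists2 e : R, 0 < e & forall s t, s \in `[0, e] -> t \in `[0, e] ->
    P (z + s *: u + t *: v).
Proof.
move=> nP.
pose k (x : R * R) := z + x.1 *: u + x.2 *: v.
have kc : {for (0, 0), continuous k}.
  apply: cvgD; last by apply: cvgZ; [exact: cvg_snd|exact: cvg_cst].
  by apply: cvgD; [exact: cvg_cst|apply: cvgZ; [exact: cvg_fst|exact: cvg_cst]].
have /nbhs_ballP[r /= r0 rP] : \forall x \near (0 : R, 0 : R), P (k x).
  by apply: kc; rewrite /k /= !scale0r !addr0.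
(* Half the radius, because the parameters fill a closed interval while the ball is open. *)
exists (r / 2); first by rewrite divr_gt0.
move=> s t; rewrite !in_itv /= => /andP[s0 sr] /andP[t0 tr].
apply: (rP (s, t)).
by split; rewrite /= -ball_normE /= sub0r normrN ger0_norm //; lra.
Qed.

(** Schwarz's theorem: the second difference over a small parallelogram is symmetric in [u] and [v],
    and it equals e^2 times either mixed derivative at some point of the parallelogram. Continuity
    at [z] then brings both values within [eps / 2] of those at [z]. *)
Lemma is_derive_symmetric {h hu hv huv hvu : V -> R} {u v z : V} :
  (\forall w \near z, [/\ is_derive w u h (hu w), is_derive w v h (hv w),
     is_derive w v hu (huv w) & is_derive w u hv (hvu w)]) ->
  {for z, continuous huv} -> {for z, continuous hvu} -> huv z = hvu z.
Proof.
move=> nh /cvgrPdist_lt cuv /cvgrPdist_lt cvu.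
apply/eqP; rewrite -subr_eq0 -normr_eq0 eq_le normr_ge0 andbT.
apply/ler_addgt0Pl => eps eps0; rewrite addr0.
have eps2 : 0 < eps / 2 by rewrite divr_gt0.
have [e e0 he] := near_parallelogram (u := u) (v := v)
  (filterI nh (filterI (cuv _ eps2) (cvu _ eps2))).
have swap s t : z + s *: v + t *: u = z + t *: u + s *: v by rewrite addrAC.
have [||s [t [sI tI E1]]] := @second_difference_MVT h hu huv u v z e e0.
- by move=> s t sI tI; have [[]] := he s t sI tI.
- by move=> s t sI tI; have [[]] := he s t sI tI.
have [||s' [t' [sI' tI' E2]]] := @second_difference_MVT h hv hvu v u z e e0.
- by move=> s' t' sI' tI'; rewrite swap; have [[]] := he t' s' tI' sI'.
- by move=> s' t' sI' tI'; rewrite swap; have [[]] := he t' s' tI' sI'.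
have E : huv (z + s *: u + t *: v) = hvu (z + t' *: u + s' *: v).
  apply: (mulIf (lt0r_neq0 e0)); apply: (mulIf (lt0r_neq0 e0)).
  by rewrite -E1 -[z + t' *: u + _]swap -E2 swap; ring.
have [_ [H1 _]] := he s t sI tI; have [_ [_ H2]] := he t' s' tI' sI'.
have := ler_normD (huv z - huv (z + s *: u + t *: v))
                  (hvu (z + t' *: u + s' *: v) - hvu z).
rewrite addrA E subrK => /le_trans; apply.
rewrite [eps]splitr; apply: lerD; first by rewrite -E ltW.
by rewrite distrC ltW.
Qed.

End SymmetryOfSecondDerivatives.

(** * Entrywise calculus for matrix-valued functions *)

Section MatrixRules.
Context {R : realType} {V : normedModType R}.

Lemma is_derive_mxP {m n : nat} {M : V -> 'M[R]_(m, n)} {dM : 'M[R]_(m, n)}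
    {z u : V} :
  is_derive z u M dM <->
  forall i j, is_derive z u (fun w => M w i j) (dM i j).
Proof.
split=> [[Md <-] i j|Md].
  by apply: DeriveDef; [exact: (derivable_mxP _ _ _).1|rewrite derive_mx// mxE].
have dM' : derivable M z u by apply/derivable_mxP => i j; have [] := Md i j.
apply: DeriveDef => //; apply/matrixP => i j.
by rewrite derive_mx// mxE; have [] := Md i j.
Qed.

Lemma is_derive_sum_fun {n : nat} {h : 'I_n -> V -> R} {dh : 'I_n -> R}
    {z u : V} :
  (forall i, is_derive z u (h i) (dh i)) ->
  is_derive z u (fun w => \sum_(i < n) h i w) (\sum_(i < n) dh i).
Proof.
move=> hd; have := is_derive_sum hd.
by congr is_derive; apply/funext => w; rewrite fct_sumE.
Qed.

Lemma is_derive_mulmx {m n k : nat} {M : V -> 'M[R]_(m, n)}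
    {N : V -> 'M[R]_(n, k)} {dM dN} {z u : V} :
  is_derive z u M dM -> is_derive z u N dN ->
  is_derive z u (fun w => M w *m N w) (dM *m N z + M z *m dN).
Proof.
move=> /is_derive_mxP Md /is_derive_mxP Nd; apply/is_derive_mxP => i j.
rewrite !mxE -big_split /=.
have -> : (fun w => (M w *m N w) i j) =
    (fun w => \sum_(l < n) M w i l * N w l j).
  by apply/funext => w; rewrite mxE.
apply: is_derive_sum_fun => l.
apply: (is_derive_eq (is_deriveM_fun (Md i l) (Nd l j))).
by rewrite [RHS]addrC [dM i l * _]mulrC.
Qed.

Lemma is_derive_trmx {m n : nat} {M : V -> 'M[R]_(m, n)} {dM} {z u : V} :
  is_derive z u M dM -> is_derive z u (fun w => (M w)^T) dM^T.
Proof.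
move=> /is_derive_mxP Md; apply/is_derive_mxP => i j; rewrite mxE.
by under eq_fun do rewrite mxE; exact: Md.
Qed.

Lemma differentiable_mxP {m n : nat} {M : V -> 'M[R]_(m, n)} {z : V} :
  differentiable M z <-> forall i j, differentiable (fun w => M w i j) z.
Proof.
split=> [Md i j|Md].
  exact: (differentiable_comp Md (differentiable_coord _ i j)).
(* Expansion in elementary matrices leaves scalar functions times constant matrices. *)
have -> : M = \sum_(i < m) \sum_(j < n) (fun w => M w i j *: delta_mx i j).
  apply/funext => w; rewrite fct_sumE [LHS]matrix_sum_delta.
  by apply: eq_bigr => i _; rewrite fct_sumE.
apply: differentiable_sum => i; apply: differentiable_sum => j.
exact: differentiableZl.
Qed.

Lemma differentiable_mulmx {m n k : nat} {M : V -> 'M[R]_(m, n)}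
    {N : V -> 'M[R]_(n, k)} {z : V} :
  differentiable M z -> differentiable N z ->
  differentiable (fun w => M w *m N w) z.
Proof.
move=> /differentiable_mxP Md /differentiable_mxP Nd.
apply/differentiable_mxP => i j.
have -> : (fun w => (M w *m N w) i j) =
    \sum_(l < n) (fun w => M w i l * N w l j).
  by apply/funext => w; rewrite mxE fct_sumE.
by apply: differentiable_sum => l; exact: differentiableM.
Qed.

Lemma differentiable_trmx {m n : nat} {M : V -> 'M[R]_(m, n)} {z : V} :
  differentiable M z -> differentiable (fun w => (M w)^T) z.
Proof.
move=> /differentiable_mxP Md; apply/differentiable_mxP => i j.
by under eq_fun do rewrite mxE; exact: Md.
Qed.

End MatrixRules.

(** * The frame equation and the trace of N^2 *)

Section FrameEquation.
Context {R : realType}.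

(* The matrix A of F_x = F A, with [alpha] = c_x / 2c; [k] and [u0] turn out
   not to contribute to the metric. *)
Definition frame_coeff (alpha P b k u0 : R) : 'M[R]_4 :=
  \matrix_(i < 4, j < 4)
    (nth [::] [:: [:: alpha;      P;     k;     u0];
                  [::     1; -alpha;     0;      k];
                  [::     0;      b; alpha;      P];
                  [::     0;      0;     1; -alpha]] i)`_j.

Lemma mulJ1J1 : J1 *m J1 = 1%:M :> 'M[R]_4.
Proof.
apply/matrixP => i j; rewrite !mxE !big_ord_recl big_ord0 !mxE.
by case: i => -[|[|[|[|//]]]] i4; case: j => -[|[|[|[|//]]]] j4;
  rewrite /= ?(mul0r, mulr0, mul1r, add0r, addr0).
Qed.

(** Conjugation by [J1] reverses the order of rows and of columns, so the alternating diagonal of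
    [alpha] and [- alpha] cancels against that of A^t. *)
Lemma J1_conj_frame_coeff (alpha P b k u0 : R) :
  let A := frame_coeff alpha P b k u0 in
  J1 *m A *m J1 + A^T =
  \matrix_(i < 4, j < 4)
    (nth [::] [:: [::     0;     2;     0;     0];
                  [:: 2 * P;     0; 2 * b;     0];
                  [:: 2 * k;     0;     0;     2];
                  [:: 2 * u0; 2 * k; 2 * P;    0]] i)`_j.
Proof.
apply/matrixP => i j; rewrite !mxE !big_ord_recl big_ord0 !mxE.
rewrite !big_ord_recl !big_ord0 !mxE.
by case: i => -[|[|[|[|//]]]] i4; case: j => -[|[|[|[|//]]]] j4;
  rewrite /= ?bump0 /=; ring.
Qed.

(** Since g^-1 X = F^-t N F^t, the trace of its square is Tr(N^2). In that trace the entries with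
    [b], [k] and [u0] meet zeros across the diagonal; four products of 2 with 2 P remain. *)
Lemma metricQ_frame (F : 'M[R]_4) (alpha P b k u0 : R) : F \in unitmx ->
  let A := frame_coeff alpha P b k u0 in
  let X := F *m (A *m J1 + J1 *m A^T) *m F^T in
  metricQ (F *m J1 *m F^T) X X = 16 * P.
Proof.
move=> Fu A X; pose N := J1 *m A *m J1 + A^T.
have FTu : F^T \in unitmx by rewrite unitmx_tr.
have J1u : J1 \in @unitmx R 4 by have [] := mulmx1_unit mulJ1J1.
have invg : invmx (F *m J1 *m F^T) = invmx F^T *m J1 *m invmx F.
  have gu : F *m J1 *m F^T \in unitmx by rewrite !unitmx_mul Fu J1u.
  apply: (can_inj (mulKmx gu)); rewrite mulmxV//.
  by rewrite !mulmxA mulmxK// -[F *m J1 *m J1]mulmxA mulJ1J1 mulmx1 mulmxV.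
have invX : invmx (F *m J1 *m F^T) *m X = invmx F^T *m N *m F^T.
  rewrite invg /X !mulmxA mulmxKV// /N; congr (_ *m _).
  rewrite -!mulmxA; congr (_ *m _).
  by rewrite mulmxDr !mulmxA mulJ1J1 mul1mx.
rewrite /metricQ -mulmxA invX !mulmxA mulmxK// mxtrace_mulC !mulmxA mulmxV//.
rewrite mul1mx /N J1_conj_frame_coeff.
rewrite /mxtrace !big_ord_recl big_ord0 !mxE !big_ord_recl !big_ord0 !mxE /=.
by ring.
Qed.

(** Follows the shape of the formula, leaving the derivative to be filled in from hypotheses.
    Subtraction is tried before addition because it is the sum with an opposite. *)
Ltac derive_step :=
  lazymatch goal with
  | |- is_derive _ _ (fun w => _ + - _) _ =>
      notypeclasses refine (is_deriveB_fun _ _); derive_step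
  | |- is_derive _ _ (fun w => _ + _) _ =>
      notypeclasses refine (is_deriveD_fun _ _); derive_step
  | |- is_derive _ _ (fun w => _ * _) _ =>
      notypeclasses refine (is_deriveM_fun _ _); derive_step
  | |- is_derive _ _ (fun w => _^-1) _ =>
      notypeclasses refine (is_deriveV_fun _ _);
      [by rewrite ?mulf_neq0 ?pnatr_eq0 | derive_step]
  | |- is_derive ?z ?u (fun w => ?f w) ?df =>
      change (is_derive z u f df); eassumption
  | |- _ => first [eassumption | exact: is_derive_cst]
  end.

(** One row of F_x = F A, where [h] stands for a coordinate of the lift and [cx], [by'] for c_x,
    b_y. The hypothesis on [hxy] is f_xxy computed from the canonical system. [k] and [u0] are
    chosen before [h], so that all rows share one matrix. *)
Lemma frame_row_derive (V : normedModType R) (u z : V)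
    (b c p by' cx : V -> R) (bx cxx bxy q py : R) :
  is_derive z u b bx -> is_derive z u c (cx z) ->
  is_derive z u cx cxx -> is_derive z u by' bxy ->
  b z != 0 -> c z != 0 ->
  exists k u0 : R, forall h hx hy hxy : V -> R,
    is_derive z u h (hx z) ->
    is_derive z u hx (b z * hy z + p z * h z) ->
    is_derive z u hy (hxy z) ->
    is_derive z u hxy (by' z * hy z + b z * (c z * hx z + q * h z)
                       + (py * h z + p z * hy z)) ->
    forall j : 'I_4,
    let row w := [:: h w; hx w - cx w / (2 * c w) * h w;
      hy w - by' w / (2 * b w) * h w;
      hxy w - cx w / (2 * c w) * hy w - by' w / (2 * b w) * hx w
        + (by' w * cx w / (4 * b w * c w) - b w * c w / 2) * h w] in
    is_derive z u (fun w => (row w)`_j)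
      (\sum_(l < 4) (row z)`_l *
         frame_coeff (cx z / (2 * c z))
           (p z + by' z / 2 - cxx / (2 * c z) + cx z ^+ 2 / (4 * c z ^+ 2))
           (b z) k u0 l j).
Proof.
move=> db dc dcx dby b0 c0.
pose al := cx z / (2 * c z); pose be := by' z / (2 * b z).
(* [al'] and [be'] are the derivatives of [al] and [be] along [u]. *)
pose al' := cxx / (2 * c z) - cx z ^+ 2 / (2 * c z ^+ 2).
pose be' := bxy / (2 * b z) - by' z * bx / (2 * b z ^+ 2).
pose P := p z + by' z / 2 - cxx / (2 * c z) + cx z ^+ 2 / (4 * c z ^+ 2).
(* [k] comes from (f_2)_x = k f + alpha f_2 + eta, and [u0] from the coefficient of f in eta_x = u0
   f + k f_1 + P f_2 - alpha eta. *)
exists (b z * c z / 2 - be').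
exists (b z * q + py - be * p z
  + (al' * be + al * be' - (bx * c z + b z * cx z) / 2)
  + al * (b z * c z / 2 - be') + be * P + al * (al * be - b z * c z / 2)).
move=> h hx hy hxy dh dhx dhy dhxy.
case=> -[|[|[|[|//]]]] j4 row; rewrite /row !big_ord_recl big_ord0 !mxE /=;
  (notypeclasses refine (is_derive_eq _ _);
    [derive_step|rewrite /P /al /be /al' /be' /=; field; by rewrite ?b0 ?c0]).
Qed.

End FrameEquation.

(** * Coordinate derivatives indexed by a Boolean *)

Section CoordinateDerivatives.
Context {R : realType}.

(** With [true] for x, [false] for y and [~~ d] for the other variable, one computation serves both
    P and Q. *)
Definition dir (d : bool) : R * R := if d then (1, 0) else (0, 1).

Definition pd {W : normedModType R} (d : bool) (h : R * R -> W) : R * R -> W :=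
  fun z => 'D_(dir d) h z.

Section Smooth.
Context {W : normedModType R}.
Implicit Types (D : set (R * R)) (h : R * R -> W) (d : bool).

Lemma smooth_on_pd {D h} d : smooth_on D h -> smooth_on D (pd d h).
Proof.
(* The derivative taken first sits at the end of the list, hence [rcons]. *)
move=> hs s z Dz; have -> : iter_pd s (pd d h) = iter_pd (rcons s d) h.
  by elim: s => [|e s IH] /=; [case: d|rewrite IH].
exact: hs.
Qed.

Lemma smooth_on_differentiable {D h z} :
  smooth_on D h -> D z -> differentiable h z.
Proof. by move=> hs; exact: (hs [::]). Qed.

Lemma smooth_on_is_derive {D h z} d :
  smooth_on D h -> D z -> is_derive z (dir d) h (pd d h z).
Proof.
by move=> hs Dz; apply: DeriveDef => //;
  exact/diff_derivable/(smooth_on_differentiable hs).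
Qed.

End Smooth.

Lemma pd_symmetric {m n : nat} {D : set (R * R)} {f : R * R -> 'M[R]_(m, n)}
    {d e : bool} {z : R * R} :
  open D -> smooth_on D f -> D z -> pd e (pd d f) z = pd d (pd e f) z.
Proof.
move=> oD fs Dz; apply/matrixP => i j.
have is_derive_entry (h : R * R -> 'M[R]_(m, n)) k w : smooth_on D h -> D w ->
    is_derive w (dir k) (fun w => h w i j) (pd k h w i j).
  by move=> hs Dw; apply: (is_derive_mxP.1 (smooth_on_is_derive k hs Dw)).
have entry_continuous (h : R * R -> 'M[R]_(m, n)) : smooth_on D h ->
    {for z, continuous (fun w => h w i j)}.
  move=> hs; apply: differentiable_continuous.
  exact: (differentiable_mxP.1 (smooth_on_differentiable hs Dz)).
apply: (is_derive_symmetric (h := fun w => f w i j)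
  (hu := fun w => pd d f w i j) (hv := fun w => pd e f w i j)
  (huv := fun w => pd e (pd d f) w i j) (hvu := fun w => pd d (pd e f) w i j)
  (u := dir d) (v := dir e)).
- have nD : \forall w \near z, D w by apply: open_nbhs_nbhs.
  apply: filterS nD => w Dw.
  by split; apply: is_derive_entry => //; exact: smooth_on_pd.
- by apply: entry_continuous; do 2 apply: smooth_on_pd.
- by apply: entry_continuous; do 2 apply: smooth_on_pd.
Qed.

End CoordinateDerivatives.

(** * The frame, its exchanged version and the Gauss map *)

Section GaussMap.
Context {R : realType}.
Implicit Types (D : set (R * R)) (f : R * R -> 'cV[R]_4).
Implicit Types (b c p q : R * R -> R) (z : R * R) (d : bool).

Definition frame_mx (v vx vy vxy : 'cV[R]_4) (alpha beta gamma : R) :=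
  \matrix_(i < 4, j < 4)
    [:: v; vx - alpha *: v; vy - beta *: v;
        vxy - alpha *: vy - beta *: vx + gamma *: v]`_j i 0.

Lemma frame_mxE (v vx vy vxy : 'cV[R]_4) (alpha beta gamma : R) (i j : 'I_4) :
  frame_mx v vx vy vxy alpha beta gamma i j =
    [:: v i 0; vx i 0 - alpha * v i 0; vy i 0 - beta * v i 0;
        vxy i 0 - alpha * vy i 0 - beta * vx i 0 + gamma * v i 0]`_j.
Proof. by rewrite mxE; case: j => -[|[|[|[|//]]]] j4; rewrite /= ?mxE. Qed.

(** F J1 F^t = f eta^t + f_1 f_2^t + f_2 f_1^t + eta f^t is symmetric in f_1 and f_2, the two
    columns that are swapped. *)
Lemma frame_mx_exchange (v vx vy vxy : 'cV[R]_4) (alpha beta gamma : R) :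
  let F := frame_mx v vx vy vxy alpha beta gamma in
  let G := frame_mx v vy vx vxy beta alpha gamma in
  G *m J1 *m G^T = F *m J1 *m F^T.
Proof.
apply/matrixP => i j; rewrite !mxE !big_ord_recl !big_ord0 !mxE.
rewrite !big_ord_recl !big_ord0 !frame_mxE !mxE /=; ring.
Qed.

(* [frame true] is the Wilczynski frame and [frame false] is the one obtained
   by exchanging x with y; the coefficients must be exchanged as well. *)
Definition frame d f b c : R * R -> 'M[R]_4 := fun z =>
  frame_mx (f z) (pd d f z) (pd (~~ d) f z) (pd (~~ d) (pd d f) z)
    (pd d c z / (2 * c z)) (pd (~~ d) b z / (2 * b z))
    (pd (~~ d) b z * pd d c z / (4 * b z * c z) - b z * c z / 2).

(** [inv true b c p] is P and [inv false c b q] is Q. *)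
Definition inv d b c p : R * R -> R := fun z =>
  p z + pd (~~ d) b z / 2 - pd d (pd d c) z / (2 * c z)
  + pd d c z ^+ 2 / (4 * c z ^+ 2).

Lemma wilczynski_frameE f b c : wilczynski_frame f b c = frame true f b c.
Proof. by []. Qed.

Lemma lin_entry {m n : nat} (a a' : R) (u v : 'M[R]_(m, n)) i j :
  (a *: u + a' *: v) i j = a * u i j + a' * v i j.
Proof. by rewrite !mxE. Qed.

(** Row [i] of the frame involves only coordinate [i] of [f] and of its derivatives, so
    [frame_row_derive] applies row by row. *)
Lemma is_derive_frame D d f b c p q z :
  open D -> smooth_on D f -> smooth_on D b -> smooth_on D c -> smooth_on D p ->
  (forall w, D w -> pd d (pd d f) w = b w *: pd (~~ d) f w + p w *: f w) ->
  (forall w, D w ->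
     pd (~~ d) (pd (~~ d) f) w = c w *: pd d f w + q w *: f w) ->
  D z -> b z != 0 -> c z != 0 ->
  exists alpha k u0 : R, is_derive z (dir d) (frame d f b c)
    (frame d f b c z *m frame_coeff alpha (inv d b c p z) (b z) k u0).
Proof.
move=> oD fs bs cs ps fxx fyy Dz b0 c0.
have der e i (h : R * R -> 'cV[R]_4) : smooth_on D h ->
    is_derive z (dir e) (fun w => h w i 0) (pd e h z i 0).
  by move=> hs; apply: (is_derive_mxP.1 (smooth_on_is_derive e hs Dz)).
have fds e := smooth_on_pd e fs.
have fdds e e' := smooth_on_pd e (fds e').
have [k [u0 row]] := @frame_row_derive _ _ (dir d) z b c p (pd (~~ d) b)
  (pd d c) _ _ _ (q z) (pd (~~ d) p z)
  (smooth_on_is_derive d bs Dz) (smooth_on_is_derive d cs Dz)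
  (smooth_on_is_derive d (smooth_on_pd d cs) Dz)
  (smooth_on_is_derive d (smooth_on_pd (~~ d) bs) Dz) b0 c0.
exists (pd d c z / (2 * c z)), k, u0; apply/is_derive_mxP => i j.
(* In the case of x: f_xyx is rewritten as f_xxy, the y-derivative of b f_y + p f, and f_yy is then
   eliminated. *)
have fxxy : pd d (pd (~~ d) (pd d f)) z i 0 =
    pd (~~ d) b z * pd (~~ d) f z i 0
    + b z * (c z * pd d f z i 0 + q z * f z i 0)
    + (pd (~~ d) p z * f z i 0 + p z * pd (~~ d) f z i 0).
  rewrite (pd_symmetric oD (fds d) Dz).
  have Dxx := der (~~ d) i _ (fdds d d).
  (* The canonical equation may be differentiated at [z] because it holds on a neighbourhood, [D]
     being open. *)
  have nxx : \forall w \near z, pd d (pd d f) w i 0 =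
      b w * pd (~~ d) f w i 0 + p w * f w i 0.
    have nD : \forall w \near z, D w by apply: open_nbhs_nbhs.
    by apply: filterS nD => w Dw; rewrite fxx// lin_entry.
  have [_ <-] := near_eq_is_derive nxx Dxx.
  have [_ ->] := is_deriveD_fun
    (is_deriveM_fun (smooth_on_is_derive (~~ d) bs Dz)
       (der (~~ d) i _ (fds (~~ d))))
    (is_deriveM_fun (smooth_on_is_derive (~~ d) ps Dz) (der (~~ d) i _ fs)).
  by rewrite fyy// lin_entry; congr (_ + _); rewrite addrC mulrC.
have fxxE : pd d (pd d f) z i 0 = b z * pd (~~ d) f z i 0 + p z * f z i 0.
  by rewrite fxx// lin_entry.
have fxyE : pd d (pd (~~ d) f) z i 0 = pd (~~ d) (pd d f) z i 0.
  by rewrite (pd_symmetric oD fs Dz).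
under eq_fun do rewrite frame_mxE.
rewrite mxE; under eq_bigr do rewrite frame_mxE.
exact: (row (fun w => f w i 0) (fun w => pd d f w i 0)
  (fun w => pd (~~ d) f w i 0) (fun w => pd (~~ d) (pd d f) w i 0)
  (der d i _ fs)
  (is_derive_eq (der d i _ (fds d)) fxxE)
  (is_derive_eq (der d i _ (fds (~~ d))) fxyE)
  (is_derive_eq (der d i _ (fdds (~~ d) d)) fxxy) j).
Qed.

Lemma frame_exchange D f b c z : open D -> smooth_on D f -> D z ->
  let F := frame false f c b z in F *m J1 *m F^T = gauss1 f b c z.
Proof.
move=> oD fs Dz; rewrite /gauss1 wilczynski_frameE /frame /=.
rewrite (pd_symmetric (d := false) (e := true) oD fs Dz).
have gammaE (x y s t : R) :
    x * y / (4 * s * t) - s * t / 2 = y * x / (4 * t * s) - t * s / 2.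
  by rewrite [x * y]mulrC [s * t]mulrC [4 * s * t]mulrAC.
by rewrite -frame_mx_exchange; congr (_ *m J1 *m _^T); congr frame_mx;
  exact: gammaE.
Qed.

(** The product rule with F_x = F A gives g_x = F (A J1 + J1 A^t) F^t, the tangent vector of
    [metricQ_frame]. *)
Lemma metricQ_gauss1 D d f b c p q z :
  open D -> smooth_on D f -> smooth_on D b -> smooth_on D c -> smooth_on D p ->
  (forall w, D w -> pd d (pd d f) w = b w *: pd (~~ d) f w + p w *: f w) ->
  (forall w, D w ->
     pd (~~ d) (pd (~~ d) f) w = c w *: pd d f w + q w *: f w) ->
  D z -> b z != 0 -> c z != 0 ->
  let F := frame d f b c in let g w := F w *m J1 *m (F w)^T in
  F z \in unitmx ->
  metricQ (g z) (pd d g z) (pd d g z) = 16 * inv d b c p z.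
Proof.
move=> oD fs bs cs ps fxx fyy Dz b0 c0 F g Fu.
have [alpha [k [u0 dF]]] := is_derive_frame D d f b c p q z
  oD fs bs cs ps fxx fyy Dz b0 c0.
have [_ dg] := is_derive_mulmx (is_derive_mulmx dF (is_derive_cst J1 z (dir d)))
  (is_derive_trmx dF).
rewrite -(metricQ_frame (F z) alpha _ (b z) k u0 Fu) -/(g z).
set A := frame_coeff _ _ _ _ _.
have dgE : pd d g z = F z *m (A *m J1 + J1 *m A^T) *m (F z)^T.
  by rewrite [LHS]dg mulmx0 addr0 trmx_mul mulmxDr mulmxDl !mulmxA.
by rewrite dgE.
Qed.

(** * Differentiability of the frame and the conformality criterion *)

Lemma differentiable_frame_mx {V : normedModType R}
    {v vx vy vxy : V -> 'cV[R]_4} {alpha beta gamma : V -> R} {z : V} :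
  differentiable v z -> differentiable vx z -> differentiable vy z ->
  differentiable vxy z -> differentiable alpha z -> differentiable beta z ->
  differentiable gamma z ->
  differentiable (fun w => frame_mx (v w) (vx w) (vy w) (vxy w)
                             (alpha w) (beta w) (gamma w)) z.
Proof.
move=> /differentiable_mxP dv /differentiable_mxP dvx /differentiable_mxP dvy.
move=> /differentiable_mxP dvxy da db dg; apply/differentiable_mxP => i j.
under eq_fun do rewrite frame_mxE.
have dM (g h : V -> R) : differentiable g z -> differentiable h z ->
  differentiable (fun w => g w * h w) z by move=> *; exact: differentiableM.
have dB (g h : V -> R) : differentiable g z -> differentiable h z ->
  differentiable (fun w => g w - h w) z by move=> *; exact: differentiableB.
have dD (g h : V -> R) : differentiable g z -> differentiable h z ->
  differentiable (fun w => g w + h w) z by move=> *; exact: differentiableD.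
by case: j => -[|[|[|[|//]]]] j4 /=;
  do ?[exact: dv|exact: dvx|exact: dvy|exact: dvxy
      |apply: (dB)|apply: (dD)|apply: (dM)].
Qed.

Lemma differentiable_frame D d f b c z :
  smooth_on D f -> smooth_on D b -> smooth_on D c -> D z ->
  b z != 0 -> c z != 0 -> differentiable (frame d f b c) z.
Proof.
move=> fs bs cs Dz b0 c0.
have df (W : normedModType R) (h : R * R -> W) :
  smooth_on D h -> differentiable h z.
  by move=> hs; exact: (smooth_on_differentiable hs Dz).
have [dcd dbd] := (df _ _ (smooth_on_pd d cs), df _ _ (smooth_on_pd (~~ d) bs)).
have two0 : (2 : R) != 0 by rewrite pnatr_eq0.
have dM (g h : R * R -> R) : differentiable g z -> differentiable h z ->
  differentiable (fun w => g w * h w) z by move=> *; exact: differentiableM.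
have dV (h : R * R -> R) : h z != 0 -> differentiable h z ->
  differentiable (fun w => (h w)^-1) z by move=> *; exact: differentiableV.
apply: differentiable_frame_mx.
- exact: df.
- exact/df/smooth_on_pd.
- exact/df/smooth_on_pd.
- exact/df/smooth_on_pd/smooth_on_pd.
- apply: (dM) => //; apply: (dV); first by rewrite mulf_neq0.
  by apply: (dM) => //; exact: df.
- apply: (dM) => //; apply: (dV); first by rewrite mulf_neq0.
  by apply: (dM) => //; exact: df.
- apply: (differentiableB
    (f := fun w => pd (~~ d) b w * pd d c w / (4 * b w * c w))).
    apply: (dM); first exact: dM.
    apply: (dV); first by rewrite !mulf_neq0// pnatr_eq0.
    by apply: (dM); [apply: (dM) => //|]; exact: df.
  by apply: (dM) => //; apply: (dM); exact: df.
Qed.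

(** The pullback is <g_x,g_x> dx^2 + 2 <g_x,g_y> dx dy + <g_y,g_y> dy^2, a multiple of dx dy exactly
    when both square terms vanish. *)
Lemma conformalP D (g : R * R -> 'M[R]_4) :
  (forall z, D z -> differentiable g z) ->
  conformal D g <->
  forall d z, D z -> metricQ (g z) (pd d g z) (pd d g z) = 0.
Proof.
move=> dg; split=> [[lambda lg] d z Dz|null].
  rewrite /pd deriveE; last exact: dg.
  by rewrite lg // /dxdy /dir; case: d => /=; ring.
(* The factor 2 compensates the division by 2 in [dxdy]. *)
exists (fun z => 2 * metricQ (g z) (pd true g z) (pd false g z)).
move=> z Dz v w.
have dgE u : 'd g z u = u.1 *: pd true g z + u.2 *: pd false g z.
  rewrite /pd !deriveE; do ?exact: dg.
  rewrite -!linearZ -linearD; congr ('d g z _).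
  case: u => u1 u2; rewrite /dir /=; congr pair => /=.
    by rewrite -[u1 *: 1]/(u1 * 1) -[u2 *: 0]/(u2 * 0); ring.
  by rewrite -[u1 *: 0]/(u1 * 0) -[u2 *: 1]/(u2 * 1); ring.
rewrite !dgE /dxdy.
have := null true z Dz; have := null false z Dz.
move: (pd true g z) (pd false g z) => X Y; rewrite /metricQ => YY XX.
(* Cyclicity of the trace makes the metric symmetric. *)
have YX : \tr (invmx (g z) *m Y *m invmx (g z) *m X) =
    \tr (invmx (g z) *m X *m invmx (g z) *m Y).
  by rewrite -mulmxA mxtrace_mulC !mulmxA.
rewrite !(mulmxDr, mulmxDl, linearD, =^~ scalemxAl, =^~ scalemxAr, linearZ) /=.
by rewrite XX YY YX; field.
Qed.

End GaussMap.

(** * Null coordinate directions and the Demoulin condition *)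

Theorem proposition2p1 (R : realType) (D : set (R * R))
    (f : R * R -> 'cV[R]_4) (b c p q : R * R -> R)
    (hD : simply_connected_domain D)
    (hf : canonical_lift D f b c p q)
    (hbc : forall z, D z -> b z * c z != 0)
    (hF : forall z, D z -> \det (wilczynski_frame f b c z) = 1) :
  conformal D (gauss1 f b c) <-> demoulin D b c p q.
Proof.
case: hD => oD _ _; case: hf => fs [bs cs ps qs] _ fxx fyy _.
have bc0 z : D z -> b z != 0 /\ c z != 0.
  by move=> /hbc; rewrite mulf_eq0 negb_or => /andP.
have Fu z : D z -> wilczynski_frame f b c z \in unitmx.
  by move=> Dz; rewrite unitmxE hF// unitr1.
have gu z : D z -> gauss1 f b c z \in unitmx.
  by move=> Dz; have [_ detg _] := gauss1_spaceQ hF Dz;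
    rewrite unitmxE detg unitr1.
have normx z : D z ->
    metricQ (gauss1 f b c z) (pd true (gauss1 f b c) z)
      (pd true (gauss1 f b c) z)
    = 16 * invP b c p z.
  move=> Dz; have [b0 c0] := bc0 z Dz.
  by apply: (metricQ_gauss1 D true f b c p q) => //; exact: Fu.
have normy z : D z ->
    metricQ (gauss1 f b c z) (pd false (gauss1 f b c) z)
      (pd false (gauss1 f b c) z) = 16 * invQ b c q z.
  move=> Dz; have [b0 c0] := bc0 z Dz.
  (* For y the exchanged frame is used: its product agrees with [gauss1] on the open set [D], hence
     so do the derivatives. *)
  pose g w := frame false f c b w *m J1 *m (frame false f c b w)^T.
  have gE w : D w -> g w = gauss1 f b c w by exact: frame_exchange.
  have dgE : pd false g z = pd false (gauss1 f b c) z.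
    apply: near_eq_derive.
    have nD : \forall w \near z, D w by apply: open_nbhs_nbhs.
    by apply: filterS nD => w; exact: gE.
  have gzu : g z \in unitmx by rewrite (gE z Dz); exact: gu.
  (* Invertibility of the exchanged frame is read off from that of the product [g z]. *)
  have Gu : frame false f c b z \in unitmx.
    by move: gzu; rewrite /g !unitmx_mul => /andP[/andP[]].
  rewrite -dgE -(gE z Dz).
  exact: (metricQ_gauss1 D false f c b q p z
    oD fs cs bs qs fyy fxx Dz c0 b0 Gu).
rewrite conformalP; last first.
  move=> z Dz; have [b0 c0] := bc0 z Dz.
  have dF : differentiable (wilczynski_frame f b c) z.
    exact: (differentiable_frame D true).
  apply: differentiable_mulmx; last exact: differentiable_trmx.
  by apply: differentiable_mulmx => //; exact: differentiable_cst.
have sixteen0 : (16 : R) != 0 by rewrite pnatr_eq0.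
split=> [null z Dz|dem d z Dz].
  have /eqP := etrans (esym (normx z Dz)) (null true z Dz).
  have /eqP := etrans (esym (normy z Dz)) (null false z Dz).
  by rewrite !mulf_eq0 !(negPf sixteen0) => /eqP ? /eqP ?.
have [P0 Q0] := dem z Dz.
case: d; first by apply: etrans (normx z Dz) _; rewrite P0 mulr0.
by apply: etrans (normy z Dz) _; rewrite Q0 mulr0.
Qed.
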